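(* Let $A$ and $C$ be finitely generated groups, and let $A*_C$ be an HNN extension of $A$ over $C$. Then $$\mathrm{asdim}(A*_C)\le\max\{\mathrm{asdim}(A),\ \mathrm{asdim}(C)+1\}.$$
   Context: An HNN extension $A*_C$ is the group $\langle A,t\mid t^{-1}ct=\varphi(c)\ \text{for all } c\in C\rangle$, where $C$ is a subgroup of $A$ and $\varphi:C\to A$ is an injective homomorphism; $t$ is the stable letter. Finitely generated groups are regarded as metric spaces via word metrics for finite generating sets. A family $\mathcal U$ of subsets of a metric space $X$ is $D$-bounded if every $U\in\mathcal U$ has diameter at most $D$; its $r$-multiplicity is the infimal integer $k$ such that every subset of $X$ of diameter at most $r$ meets at most $k$ members of $\mathcal U$. $\mathrm{asdim}(X)$ (asymptotic dimension) is the smallest $n\in\mathbb N\cup\{\infty\}$ such that for all $r>0$ there exist $D(r)<\infty$ and a $D(r)$-bounded cover of $X$ with $r$-multiplicity at most $n+1$. *)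

(* Defs.v *)
From HB Require Import structures.
From mathcomp Require Import all_boot all_order all_algebra.
From mathcomp Require Import generic_quotient monoid.
From mathcomp Require Import all_classical all_reals all_analysis.

Set Implicit Arguments.
Unset Strict Implicit.
Unset Printing Implicit Defensive.

Import Order.TTheory GRing.Theory Num.Theory.

Local Open Scope classical_set_scope.
Local Open Scope card_scope.
Local Open Scope quotient_scope.
Local Open Scope ring_scope.

Section Asdim.
Context {R : realType} {X : metricType R}.
Implicit Types (B : set X) (F : set (set X)).

Definition diam B : \bar R := ereal_sup [set (mdist p.1 p.2)%:E | p in B `*` B].

Definition bounded_family (D : R) F := forall U, F U -> (diam U <= D%:E)%E.

Definition covers F := \bigcup_(U in F) U = [set: X].

Definition meets_at_most (r : R) F (k : nat) := forall B, (diam B <= r%:E)%E ->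
  [set U | F U /\ U `&` B !=set0] #<= `I_k.

(* +oo when no k is suitable. *)
Definition multiplicity (r : R) F : \bar R :=
  ereal_inf [set k%:R%:E | k in meets_at_most r F].

Definition asdim_at_most (n : nat) := forall r : R, 0 < r ->
  exists (D : R) F,
    [/\ bounded_family D F, covers F & (multiplicity r F <= n.+1%:R%:E)%E].

End Asdim.

(* +oo when no n is suitable. *)
Definition asdim {R : realType} (X : metricType R) : \bar R :=
  ereal_inf [set n%:R%:E | n in @asdim_at_most R X].

Section WordLength.
Context {G : groupType}.
Local Open Scope group_scope.
Implicit Types (S w : seq G) (g h : G).

Definition is_word S w := all (fun x => (x \in S) || (x^-1 \in S)) w.

Definition generates S :=
  forall g, exists w, is_word S w /\ \prod_(x <- w) x = g.

End WordLength.

(* Finite generating sets, listed; [genset G] is inhabited exactly when G is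
   finitely generated. *)
Record genset (G : groupType) :=
  Genset { gens :> seq G; gens_generate : generates gens }.

Section WordMetric.
Context {G : groupType} (S : genset G).
Local Open Scope group_scope.
Implicit Types (g h k : G) (w : seq G).

Definition has_word_of_size g (n : nat) :=
  exists w, [/\ is_word S w, \prod_(x <- w) x = g & size w = n].

Lemma ex_word_size g : exists n, `[< has_word_of_size g n >].
Proof.
by have [w [Sw wg]] := gens_generate S g; exists (size w); apply/asboolP; exists w.
Qed.

Definition word_length g : nat := ex_minn (ex_word_size g).

Lemma word_lengthP g : has_word_of_size g (word_length g).
Proof. by rewrite /word_length; case: ex_minnP => n /asboolP. Qed.

Lemma word_length_min g w :
  is_word S w -> \prod_(x <- w) x = g -> (word_length g <= size w)%N.
Proof.
move=> Sw wg; rewrite /word_length; case: ex_minnP => n _; apply.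
by apply/asboolP; exists w.
Qed.

Lemma word_length1 : word_length 1 = 0%N.
Proof.
by apply/eqP; rewrite -leqn0 (@word_length_min _ [::]) // big_nil.
Qed.

Lemma word_length_eq0 g : word_length g = 0%N -> g = 1.
Proof.
move=> g0; have [w [_ wg]] := word_lengthP g; rewrite g0 -wg.
by move=> /size0nil ->; rewrite big_nil.
Qed.

Lemma word_lengthM g h : (word_length (g * h) <= word_length g + word_length h)%N.
Proof.
have [u [Su ug <-]] := word_lengthP g; have [v [Sv vh <-]] := word_lengthP h.
rewrite -size_cat word_length_min //; first by rewrite /is_word all_cat; apply/andP.
by rewrite big_cat /= ug vh.
Qed.

Lemma prod_rev_inv w :
  \prod_(x <- rev [seq y^-1 | y <- w]) x = (\prod_(x <- w) x)^-1.
Proof.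
elim: w => [|x w IHw]; first by rewrite !big_nil invg1.
by rewrite /= rev_cons -cats1 big_cat /= big_seq1 IHw big_cons invgM.
Qed.

Lemma word_lengthV g : word_length g^-1 = word_length g.
Proof.
suff le h : (word_length h^-1 <= word_length h)%N.
  by apply/eqP; rewrite eqn_leq le /= -[in X in (X <= _)%N](invgK g) le.
have [w [Sw wh <-]] := word_lengthP h.
rewrite -(size_map (fun x : G => x^-1)) -size_rev word_length_min ?prod_rev_inv ?wh //.
rewrite /is_word all_rev all_map; apply: sub_all Sw => x /=.
by rewrite invgK orbC.
Qed.

End WordMetric.

(* G with the word metric of S, as a metric space with real-valued distance. *)
Definition word_space (R : realType) (G : groupType) (S : genset G) : Type := G.

Section WordSpace.
Context {R : realType} {G : groupType} (S : genset G).

Definition word_dist (g h : word_space R S) : R :=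
  (word_length S ((g : G)^-1 * (h : G))%g)%:R.

Lemma word_distxx g : word_dist g g = 0.
Proof. by rewrite /word_dist mulVg word_length1. Qed.

Lemma word_dist_eq0 g h : word_dist g h = 0 -> g = h.
Proof.
move=> /eqP; rewrite pnatr_eq0 => /eqP/word_length_eq0 gh.
by rewrite -[RHS](@mulVKg G g) gh mulg1.
Qed.

Lemma word_distC g h : word_dist g h = word_dist h g.
Proof. by rewrite /word_dist -word_lengthV invgM invgK. Qed.

Lemma word_dist_triangle h g k :
  word_dist g k <= word_dist g h + word_dist h k.
Proof.
rewrite -natrD ler_nat; apply: leq_trans (word_lengthM _ _ _).
by rewrite -mulgA mulVKg.
Qed.

HB.instance Definition _ := Choice.copy (word_space R S) G.
HB.instance Definition _ := isMetric.Build R (word_space R S)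
  word_distxx word_dist_eq0 word_distC word_dist_triangle.

End WordSpace.

(* A word over X and its formal inverses: (x, false) is x, (x, true) is x^-1. *)
Definition fword (X : Type) := seq (X * bool).

Section Presentation.
Context {X : choiceType}.
Implicit Types (u v w : fword X) (rel : fword X -> fword X -> Prop).

Definition flip_letter (l : X * bool) := (l.1, ~~ l.2).
Definition fword_inv w : fword X := rev (map flip_letter w).

(* Equality of words in the group <X | u = v whenever rel u v>. *)
Inductive pres_eq rel : fword X -> fword X -> Prop :=
| pres_refl u : pres_eq rel u u
| pres_sym u v : pres_eq rel u v -> pres_eq rel v u
| pres_trans v u w : pres_eq rel u v -> pres_eq rel v w -> pres_eq rel u w
| pres_cat u u' v v' :
    pres_eq rel u u' -> pres_eq rel v v' -> pres_eq rel (u ++ v) (u' ++ v')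
| pres_cancel l : pres_eq rel [:: l; flip_letter l] [::]
| pres_rel u v : rel u v -> pres_eq rel u v.

Definition pres_eqb rel : fword X -> fword X -> bool :=
  fun u v => `[< pres_eq rel u v >].

Lemma pres_eqb_refl rel : reflexive (pres_eqb rel).
Proof. by move=> u; apply/asboolP; apply: pres_refl. Qed.

Lemma pres_eqb_sym rel : symmetric (pres_eqb rel).
Proof. by move=> u v; apply/asboolP/asboolP; apply: pres_sym. Qed.

Lemma pres_eqb_trans rel : transitive (pres_eqb rel).
Proof.
by move=> v u w /asboolP uv /asboolP vw; apply/asboolP; apply: pres_trans uv vw.
Qed.

Canonical pres_equiv rel := EquivRel (pres_eqb rel)
  (pres_eqb_refl rel) (pres_eqb_sym rel) (@pres_eqb_trans rel).

Definition presented rel := {eq_quot (pres_eqb rel)}.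

Section PresentedGroup.
Context (rel : fword X -> fword X -> Prop).

HB.instance Definition _ := Choice.on (presented rel).

Definition wclass w : presented rel := \pi_({eq_quot (pres_eqb rel)}) w.
Definition wrepr (g : presented rel) : fword X := repr (g : {eq_quot (pres_eqb rel)}).

Lemma wreprK g : wclass (wrepr g) = g.
Proof. exact: reprK. Qed.

Lemma wclassP u v : wclass u = wclass v <-> pres_eq rel u v.
Proof. by split=> [/eqmodP/asboolP|uv]; [|apply/eqmodP/asboolP]. Qed.

Lemma wrepr_class u : pres_eq rel (wrepr (wclass u)) u.
Proof. by apply/wclassP; rewrite wreprK. Qed.

Lemma pres_catV u : pres_eq rel (u ++ fword_inv u) [::].
Proof.
elim: u => [|l u IHu]; first exact: pres_refl.
have -> : (l :: u) ++ fword_inv (l :: u) =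
    [:: l] ++ ((u ++ fword_inv u) ++ [:: flip_letter l]).
  by rewrite /fword_inv /= rev_cons -cats1 !catA.
apply: (@pres_trans _ ([:: l] ++ ([::] ++ [:: flip_letter l]))); last exact: pres_cancel.
by apply: pres_cat; [exact: pres_refl|apply: pres_cat => //; exact: pres_refl].
Qed.

Lemma fword_invK : involutive fword_inv.
Proof.
move=> u; rewrite /fword_inv map_rev revK -map_comp map_id_in // => -[x b] _.
by rewrite /flip_letter /= negbK.
Qed.

Lemma pres_catVl u : pres_eq rel (fword_inv u ++ u) [::].
Proof. by have := pres_catV (fword_inv u); rewrite fword_invK. Qed.

Lemma pres_finv u v : pres_eq rel u v -> pres_eq rel (fword_inv u) (fword_inv v).
Proof.
move=> uv; apply: (@pres_trans _ (fword_inv u ++ (v ++ fword_inv v))).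
  rewrite -[X in pres_eq _ X _]cats0; apply: pres_cat; first exact: pres_refl.
  exact/pres_sym/pres_catV.
rewrite catA -[X in pres_eq _ _ X]cat0s; apply: pres_cat; last exact: pres_refl.
apply: (@pres_trans _ (fword_inv u ++ u)); last exact: pres_catVl.
by apply: pres_cat; [exact: pres_refl|exact: pres_sym].
Qed.

Definition pres_mul (g h : presented rel) := wclass (wrepr g ++ wrepr h).
Definition pres_inv (g : presented rel) := wclass (fword_inv (wrepr g)).

Lemma pres_mulE u v : pres_mul (wclass u) (wclass v) = wclass (u ++ v).
Proof. by apply/wclassP; apply: pres_cat; apply: wrepr_class. Qed.

Lemma pres_invE u : pres_inv (wclass u) = wclass (fword_inv u).
Proof. exact/wclassP/pres_finv/wrepr_class. Qed.

Lemma pres_mulA : associative pres_mul.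
Proof.
move=> a b c; rewrite -(wreprK a) -(wreprK b) -(wreprK c) !pres_mulE.
by rewrite catA.
Qed.

Lemma pres_mul1 : left_id (wclass [::]) pres_mul.
Proof. by move=> a; rewrite -(wreprK a) pres_mulE. Qed.

Lemma pres_1mul : right_id (wclass [::]) pres_mul.
Proof. by move=> a; rewrite -(wreprK a) pres_mulE cats0. Qed.

Lemma pres_mulV : left_inverse (wclass [::]) pres_inv pres_mul.
Proof.
by move=> a; rewrite -(wreprK a) pres_invE pres_mulE; apply/wclassP/pres_catVl.
Qed.

Lemma pres_Vmul : right_inverse (wclass [::]) pres_inv pres_mul.
Proof.
by move=> a; rewrite -(wreprK a) pres_invE pres_mulE; apply/wclassP/pres_catV.
Qed.

HB.instance Definition _ := isGroup.Build (presented rel)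
  pres_mulA pres_mul1 pres_1mul pres_mulV pres_Vmul.

Lemma wclassM u v : (wclass u * wclass v)%g = wclass (u ++ v).
Proof. exact: pres_mulE. Qed.

Lemma wclassV u : ((wclass u)^-1)%g = wclass (fword_inv u).
Proof. exact: pres_invE. Qed.

Lemma wclass1 : wclass [::] = 1%g.
Proof. by []. Qed.

End PresentedGroup.
End Presentation.

Section HNN.
Context {A : groupType} {P : pred A} {C : subGroupType P}.
Context (phi : {multiplicative C -> A}).

(* Generators: Some a for a in A, and None for the stable letter t. *)
Definition aletter (a : A) : option A * bool := (Some a, false).
Definition tletter : option A * bool := (None, false).

Inductive hnn_rel : fword (option A) -> fword (option A) -> Prop :=
| hnn_relM (a b : A) : hnn_rel [:: aletter a; aletter b] [:: aletter (a * b)%g]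
| hnn_relC (c : C) :
    hnn_rel [:: flip_letter tletter; aletter (val c); tletter] [:: aletter (phi c)].

(* <A, t | t^-1 c t = phi c for c in C>; it is the HNN extension of A over C
   when phi is injective. *)
Definition hnn : groupType := presented hnn_rel.

Definition hnn_base (a : A) : hnn := wclass hnn_rel [:: aletter a].
Definition hnn_stable : hnn := wclass hnn_rel [:: tletter].

Local Open Scope group_scope.

Lemma hnn_baseM : {morph hnn_base : a b / a * b}.
Proof.
move=> a b; rewrite /hnn_base wclassM; apply/wclassP/pres_sym/pres_rel.
exact: hnn_relM.
Qed.

HB.instance Definition _ := isMultiplicative.Build A hnn hnn_base hnn_baseM.

Lemma hnn_conj (c : C) :
  hnn_stable^-1 * hnn_base (val c) * hnn_stable = hnn_base (phi c).
Proof.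
rewrite wclassV [X in X * _]wclassM wclassM.
exact/wclassP/pres_rel/hnn_relC.
Qed.

Lemma hnn_base1 : hnn_base 1 = 1.
Proof.
by apply: (@mulgI _ (hnn_base 1)); rewrite -hnn_baseM !mulg1.
Qed.

Lemma hnn_baseV a : hnn_base a^-1 = (hnn_base a)^-1.
Proof. by apply/esym/mulg1_eq; rewrite -hnn_baseM mulgV hnn_base1. Qed.

Lemma hnn_generates (S : genset A) :
  generates (hnn_stable :: map hnn_base S).
Proof.
move=> g; rewrite -(wreprK g); elim: (wrepr g) => [|[x b] w [u [Su uw]]].
  by exists [::]; rewrite big_nil.
suff [v [Sv vx]] : exists v, is_word (hnn_stable :: map hnn_base S) v /\
    \prod_(y <- v) y = wclass hnn_rel [:: (x, b)].
  exists (v ++ u); split; first by rewrite /is_word all_cat; apply/andP.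
  by rewrite big_cat /= vx uw wclassM.
case: x => [a|].
  have [v [Sv va]] :=
    gens_generate S (if b then a^-1 else a).
  exists (map hnn_base v); split.
    rewrite /is_word all_map; apply: sub_all Sv => y /= Sy; rewrite !inE.
    case/orP: Sy => Sy; first by rewrite (map_f hnn_base Sy) orbT.
    by rewrite -hnn_baseV (map_f hnn_base Sy) !orbT.
  have -> : wclass hnn_rel [:: (Some a, b)] = hnn_base (if b then a^-1 else a).
    by case: b {va} => //; rewrite hnn_baseV /hnn_base wclassV.
  rewrite -va big_map; elim: v {Sv va} => [|y v IHv].
    by rewrite !big_nil hnn_base1.
  by rewrite !big_cons hnn_baseM IHv.
exists [:: wclass hnn_rel [:: (None, b)]]; split; last by rewrite big_seq1.
rewrite /is_word /= andbT !inE; case: b; last by rewrite eqxx.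
by rewrite wclassV [in X in _ || X]/= eqxx !orbT.
Qed.

Definition hnn_genset (S : genset A) : genset hnn := Genset (hnn_generates S).

End HNN.

(* Main.v *)
Require Import Defs.
From mathcomp Require Import all_boot all_order all_algebra monoid.
From mathcomp Require Import all_classical all_reals all_analysis.
From mathcomp Require Import zify.

(** The group G = A*_C acts on its Bass-Serre tree T, whose vertices are the cosets
    gA and whose edges are the cosets gC.  Cut T along a set of edges, and give each
    cut edge a collar of width rho, on the side away from the root.  A collar lies
    near a coset of C, hence has a cover coloured with n colours, where
    n = max (asdim A, asdim C + 1), such that sets of one colour are far apart.  The
    pieces on both sides have covers of multiplicity n + 1 at the much larger scale
    of the diameters in the collar cover, so each set K of the collar can be pushed
    into one set of the parent piece and into one of the child piece.  Inside the
    collar one passes from the parent cover to K and then from K to the child cover,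
    the colours switching one after the other at distinct depths; a small ball then
    meets at most one set of each colour, plus one.  This is the mapping-cylinder
    argument: the collar contributes asdim C + 1 dimensions and no more.

    Cutting along the edges of height m + 1 shows by induction that the points of
    height at most m form a set of dimension at most n.  Cutting along the edges
    whose height is a multiple of a number M, large compared with rho, leaves
    uniformly n-dimensional pieces of bounded height, and gives the bound for G.

    Height, subtrees and edges are read off the normal form of an element of G. *)

Set Implicit Arguments.
Unset Strict Implicit.
Unset Printing Implicit Defensive.

Import Order.TTheory GRing.Theory Num.Theory.

Local Open Scope group_scope.
Local Open Scope classical_set_scope.

(** * Word metrics *)

Section WordMetric.
Context {G : groupType} (S : genset G).
Implicit Types (g x y z : G).

Definition wdist x y : nat := word_length S (x^-1 * y).

Definition is_letter (s : G) : bool := (s \in gens S) || (s^-1 \in gens S).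

Lemma wdistxx x : wdist x x = 0%N.
Proof. by rewrite /wdist mulVg word_length1. Qed.

Lemma wdistC x y : wdist x y = wdist y x.
Proof. by rewrite /wdist -word_lengthV invgM invgK. Qed.

Lemma wdist_triangle y x z : (wdist x z <= wdist x y + wdist y z)%N.
Proof.
by rewrite /wdist; apply: leq_trans (word_lengthM _ _ _); rewrite -mulgA mulVKg.
Qed.

Lemma wdistMl g x y : wdist (g * x) (g * y) = wdist x y.
Proof. by rewrite /wdist invgM -mulgA mulKg. Qed.

Lemma wdistMVl g x y : wdist (g^-1 * x) y = wdist x (g * y).
Proof. by rewrite -(wdistMl g) mulVKg. Qed.

Lemma wdist_mulr x s : wdist x (x * s) = word_length S s.
Proof. by rewrite /wdist mulKg. Qed.

Lemma word_length_letter s : is_letter s -> (word_length S s <= 1)%N.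
Proof.
by move=> Ss; rewrite (@word_length_min _ S s [:: s]) ?big_seq1 //= andbT.
Qed.

Lemma wdist_step x y : x != y ->
  exists z s, [/\ is_letter s, y = z * s & (wdist x z < wdist x y)%N].
Proof.
move=> xy; have [w [Sw wp ws]] := word_lengthP S (x^-1 * y).
case/lastP: w Sw wp ws => [|w s] Sw wp ws.
  by move: wp xy; rewrite big_nil => /esym/mulg1_eq; rewrite invgK => ->; rewrite eqxx.
exists (x * \prod_(i <- w) i), s; move: Sw; rewrite /is_word all_rcons => /andP[Ss Sw].
split=> //.
  by rewrite -mulgA; move: wp; rewrite -cats1 big_cat big_seq1 => ->; rewrite mulVKg.
by rewrite wdist_mulr /wdist -ws size_rcons ltnS word_length_min.
Qed.

Lemma word_ball_finite r :
  exists b : seq G, forall g, (word_length S g <= r)%N -> g \in b.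
Proof.
elim: r => [|r [b IH]].
  by exists [:: 1] => g; rewrite leqn0 => /eqP/word_length_eq0 ->; rewrite inE.
exists (1 :: allpairs *%g b (gens S ++ [seq s^-1 | s <- gens S])) => g gr.
rewrite inE; case: eqVneq => //= g1.
have [z [s [Ss gE zr]]] := @wdist_step 1 g ltac:(by rewrite eq_sym).
apply/allpairsP; exists (z, s); split=> //=.
  apply: IH; rewrite -ltnS; apply: leq_trans gr.
  by move: zr; rewrite /wdist invg1 !mul1g.
rewrite mem_cat; case/orP: Ss => [->//|Ss]; apply/orP; right.
by apply/mapP; exists s^-1 => //; rewrite invgK.
Qed.

End WordMetric.

(** * Injective homomorphisms as coarse embeddings *)

Section InjectiveMorphism.
Context {H G : groupType} (SH : genset H) (SG : genset G).
Context (f : H -> G) (fM : {morph f : x y / x * y}).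

Lemma morph_group1 : f 1 = 1.
Proof. by apply: (@mulgI _ (f 1)); rewrite -fM !mulg1. Qed.

Lemma morph_groupV x : f x^-1 = (f x)^-1.
Proof. by apply/esym/mulg1_eq; rewrite -fM mulgV morph_group1. Qed.

Lemma morph_wdist_le : exists K, forall x y,
  (wdist SG (f x) (f y) <= K * wdist SH x y)%N.
Proof.
pose K := \max_(s <- gens SH) word_length SG (f s).
suff KP h : (word_length SG (f h) <= K * word_length SH h)%N.
  by exists K => x y; rewrite /wdist -morph_groupV -fM.
have [w [Sw <- <-]] := word_lengthP SH h; elim: w Sw => [|s w IH] /= Sw.
  by rewrite big_nil morph_group1 word_length1.
move: Sw => /andP[Ss Sw].
rewrite big_cons fM mulnS (leq_trans (word_lengthM _ _ _))// leq_add ?IH//.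
case/orP: Ss => Ss; first exact: (@leq_bigmax_seq _ _ xpredT (fun s => word_length SG (f s))).
rewrite -word_lengthV -morph_groupV.
exact: (@leq_bigmax_seq _ _ xpredT (fun s => word_length SG (f s))).
Qed.

Hypothesis f_inj : injective f.

(** Balls of [G] are finite, so by injectivity only finitely many elements of [H] land in a given
    ball; [r'] bounds their lengths. *)
Lemma inj_morph_wdist_proper r : exists r', forall x y,
  (wdist SG (f x) (f y) <= r)%N -> (wdist SH x y <= r')%N.
Proof.
have [b bP] := word_ball_finite SG r.
pose h g := xget 1 [set h | f h = g].
have fK x : h (f x) = x.
  by apply: f_inj; rewrite /h; case: xgetP => [y _ //|/(_ x) []].
exists (\max_(g <- b) word_length SH (h g)) => x y.
rewrite /wdist -morph_groupV -fM => /bP fb; rewrite -[X in word_length SH X]fK.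
exact: (@leq_bigmax_seq _ _ xpredT (fun g => word_length SH (h g))).
Qed.

End InjectiveMorphism.

(** * Dimension via labellings *)

(** Serves the chain argument of [mdim_cdim]: a nested chain of predicates whose count on [s] stops
    growing has stalled on [s]. *)
Lemma count_sub_eq (T : eqType) (p q : pred T) (s : seq T) :
    {in s, forall x, p x -> q x} ->
  (count p s <= count q s)%N /\
  (count p s = count q s -> {in s, forall x, q x -> p x}).
Proof.
elim: s => //= x s IH pq.
have [|le_pq eq_pq] := IH; first by move=> y ys; apply: pq; rewrite inE ys orbT.
have := pq x (mem_head _ _); case px: (p x); case qx: (q x) => pqx /=.
- split; first by lia.
  move=> eqc y; have /eq_pq pq' : count p s = count q s by lia.
  by rewrite inE => /predU1P[->|/pq'].
- by have := pqx isT.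
- by split; [lia|move=> ?; lia].
- split; first by lia.
  move=> eqc y; have /eq_pq pq' : count p s = count q s by lia.
  rewrite inE => /predU1P[->|/pq' //].
  by rewrite qx.
Qed.

Section Labellings.
Context {G : groupType} (S : genset G).
Implicit Types (x y z : G) (Y : set G).

(* A cover of Y is encoded by a function lab on G: its members are the fibres of
   lab on Y.  Covers may be taken disjoint, as shrinking members harms neither
   boundedness nor multiplicity. *)
Definition bounded_labelling Y D (I : Type) (lab : G -> I) :=
  forall x y, Y x -> Y y -> lab x = lab y -> (wdist S x y <= D)%N.

Definition ball_meets_labels Y r k (I : choiceType) (lab : G -> I) :=
  forall z, exists s : seq I, (size s <= k)%N /\
    forall y, Y y -> (wdist S z y <= r)%N -> lab y \in s.

Definition mdim_at Y r n := exists D (I : choiceType) (lab : G -> I),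
  bounded_labelling Y D lab /\ ball_meets_labels Y r n.+1 lab.

Definition mdim_le Y n := forall r, mdim_at Y r n.

(** The coloured form of dimension, where [k] colours stand for dimension [k - 1]: distinct sets of
    one colour are more than [r] apart. *)
Definition cdim_le Y k := forall r,
  exists D (I : choiceType) (col : G -> nat) (lab : G -> I),
  [/\ forall x, Y x -> (col x < k)%N,
      bounded_labelling Y D (fun x => (col x, lab x)) &
      forall x y, Y x -> Y y -> col x = col y -> (wdist S x y <= r)%N ->
        lab x = lab y].

Lemma mdim_le_mono Y n n' : (n <= n')%N -> mdim_le Y n -> mdim_le Y n'.
Proof.
move=> nn' dY r; have [D [I [lab [bd ml]]]] := dY r; exists D, I, lab.
by split=> // z; have [s [sn sP]] := ml z; exists s; split; [lia|].
Qed.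

Lemma cdim_le_mono Y k k' : (k <= k')%N -> cdim_le Y k -> cdim_le Y k'.
Proof.
move=> kk' dY r; have [D [I [col [lab [ck bd cl]]]]] := dY r.
by exists D, I, col, lab; split=> // x /ck; lia.
Qed.

(* With N j x the labels seen from x within distance j * r, an increasing chain
   N 0 x, ..., N n.+1 x of nonempty sets of at most n.+1 labels must stall at
   some j <= n; colour x by such a j and label it by N j x. *)
Lemma mdim_cdim Y n : mdim_le Y n -> cdim_le Y n.+1.
Proof.
move=> dY r; have [D [I [lab [bd ml]]]] := dY (n.+1 * r)%N.
pose N j x := [set i | exists y, [/\ Y y, lab y = i & (wdist S x y <= j * r)%N]].
have NS j x : N j x `<=` N j.+1 x.
  move=> i [y [Yy yi xy]]; exists y; split=> //; apply: leq_trans xy _.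
  by rewrite leq_mul2r leqnSn orbT.
have stall x : Y x -> exists j, (j < n.+1)%N /\ N j x = N j.+1 x.
  move=> Yx; have [s [ssz sP]] := ml x.
  have Ns j i : (j <= n.+1)%N -> N j x i -> i \in s.
    move=> jn [y [Yy <- xy]]; apply: sP => //; apply: leq_trans xy _.
    by rewrite leq_mul2r jn orbT.
  pose c j := count (fun i => `[< N j x i >]) s.
  have cS j := @count_sub_eq _ (fun i => `[< N j x i >]) (fun i => `[< N j.+1 x i >]) s
    (fun i _ => ltac:(by move=> /asboolP/NS/asboolP)).
  apply: contrapT => nostall.
  have cj j : (j <= n.+1)%N -> (j < c j)%N.
    elim: j => [_|j IH jn].
      rewrite -has_count; apply/hasP; exists (lab x); first by apply: sP => //; rewrite wdistxx.
      by apply/asboolP; exists x; split=> //; rewrite wdistxx.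
    have {}IH := IH (ltnW jn); have [le_c eq_c] := cS j.
    rewrite -/(c j) -/(c j.+1) in le_c eq_c.
    suff : c j <> c j.+1 by lia.
    move=> /eq_c cc; apply: nostall; exists j; split=> //.
    apply/seteqP; split; first exact: NS.
    move=> i Ni; apply/asboolP; apply: cc; last exact/asboolP.
    exact: Ns Ni.
  have := cj n.+1 (leqnn _); have := count_size (fun i => `[< N n.+1 x i >]) s.
  by rewrite -/(c _); lia.
pose col x := xget 0%N [set j | (j < n.+1)%N /\ N j x = N j.+1 x].
have colP x : Y x -> (col x < n.+1)%N /\ N (col x) x = N (col x).+1 x.
  by move=> /stall; exact: (@xgetPex _ 0%N [set j | (j < n.+1)%N /\ N j x = N j.+1 x]).
exists (n.+1 * r + D)%N, (set I : choiceType), col, (fun x => N (col x) x); split.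
- by move=> x /colP[].
- move=> x y Yx Yy [cc NN].
  have : N (col x) x (lab x) by exists x; split=> //; rewrite wdistxx.
  (* The common label set contains the label of [x], so some [z] near [y] carries it. *)
  rewrite NN => -[z [Yz zx yz]]; rewrite wdistC.
  apply: leq_trans (wdist_triangle S z y x) (leq_add _ (bd _ _ Yz Yx zx)).
  by apply: leq_trans yz _; rewrite leq_mul2r ltnW ?orbT //; case: (colP y Yy).
- suff NN x y : Y x -> Y y -> col x = col y -> (wdist S x y <= r)%N ->
      N (col x) x `<=` N (col y) y.
    move=> x y Yx Yy cc xy; apply/seteqP; split; apply: NN => //.
    by rewrite wdistC.
  (* Moving from [x] to [y] costs one more [r], which the stall at [y] absorbs. *)
  move=> Yx Yy cc xy i [z [Yz zi xz]]; rewrite (colP y Yy).2.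
  exists z; split=> //; apply: leq_trans (wdist_triangle S x y z) _.
  by rewrite mulSn leq_add ?[wdist S y x]wdistC -?cc.
Qed.

Definition nbhd rho Y := [set x | exists2 y, Y y & (wdist S x y <= rho)%N].

(** The colouring is pulled back along a choice of a point of [Y] within [rho]; this changes
    distances by at most [2 * rho]. *)
Lemma cdim_nbhd Y k rho : cdim_le Y k -> cdim_le (nbhd rho Y) k.
Proof.
move=> dY r; have [D [I [col [lab [ck bd cl]]]]] := dY (rho + r + rho)%N.
pose near x := xget x [set y | Y y /\ (wdist S x y <= rho)%N].
have nearP x : nbhd rho Y x -> Y (near x) /\ (wdist S x (near x) <= rho)%N.
  case=> y Yy xy; apply: (@xgetPex _ x [set y | Y y /\ (wdist S x y <= rho)%N]).
  by exists y.
exists (rho + D + rho)%N, I, (col \o near), (lab \o near); split=> /=.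
- by move=> x /nearP[/ck].
- move=> x y /nearP[Yx xx] /nearP[Yy yy] xy.
  have := bd _ _ Yx Yy xy; have := wdist_triangle S (near x) x y.
  have := wdist_triangle S (near y) (near x) y; rewrite (wdistC S (near y) y); lia.
- move=> x y /nearP[Yx xx] /nearP[Yy yy] cc xy; apply: cl => //.
  have := wdist_triangle S x (near x) (near y); have := wdist_triangle S y x (near y).
  rewrite (wdistC S (near x) x); lia.
Qed.

End Labellings.

(** * Comparison with asdim *)

Section Cardinality.
Context {T : choiceType}.
Local Open Scope card_scope.

Lemma card_le_seq (A : set T) k : A #<= `I_k ->
  exists s : seq T, (size s <= k)%N /\ forall x, A x -> x \in s.
Proof.
move=> Ak; have finA : finite_set A by apply/finite_set_leP; exists k.
exists (finmap.enum_fset (fset_set A)); split; last by move=> x Ax; rewrite (in_fset_set finA) inE.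
have /finite_setP[m Am] := finA.
rewrite (card_fset_set Am) -card_le_II; apply: card_le_trans Ak.
by move: Am; rewrite card_eq_le => /andP[].
Qed.

Lemma seq_card_le (A : set T) (s : seq T) k : (size s <= k)%N ->
  (forall x, A x -> x \in s) -> A #<= `I_k.
Proof.
move=> sk As; case: (pselect (A !=set0)) => [[x0 _]|A0]; last first.
  suff -> : A = set0 by exact: card_ge0.
  by apply/seteqP; split=> // x Ax; apply: A0; exists x.
apply: card_le_trans (card_image_le (nth x0 s) `I_k).
apply: subset_card_le => x /As xs; exists (index x s); last exact: nth_index.
by apply: leq_trans sk; rewrite index_mem.
Qed.

End Cardinality.

Section Multiplicity.
Context {R : realType} {X : metricType R}.
Local Open Scope ring_scope.

(** Suitable bounds are closed upwards, so if [n] fails then the infimum is at least [n + 1]. *)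
Lemma multiplicityP (r : R) (F : set (set X)) (n : nat) :
  (multiplicity r F <= n%:R%:E)%E <-> meets_at_most r F n.
Proof.
split=> [|rFn]; last by apply: ge_ereal_inf; exists n%:R%:E => //; exists n.
apply: contraPP => nrF; apply/negP; rewrite -ltNge.
apply: (@lt_le_trans _ _ (n.+1%:R%:E)); first by rewrite lte_fin ltr_nat.
apply: le_ereal_inf_tmp => _ [k rFk <-]; rewrite lee_fin ler_nat ltnNge.
apply/negP => kn; apply: nrF => B /rFk; move/card_le_trans; apply.
by rewrite card_le_II.
Qed.

Lemma diam_le (r : R) (B : set X) :
  (forall x y, B x -> B y -> mdist x y <= r) -> (diam B <= r%:E)%E.
Proof.
move=> Br; apply: ge_ereal_sup => _ [[x y] [/= Bx By] <-].
by rewrite lee_fin Br.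
Qed.

Lemma le_diam (r : R) (B : set X) x y :
  (diam B <= r%:E)%E -> B x -> B y -> mdist x y <= r.
Proof.
move=> Br Bx By; rewrite -lee_fin; apply: le_trans Br.
by apply: ereal_sup_ubound; exists (x, y).
Qed.

End Multiplicity.

Section AsdimWordSpace.
Context {R : realType} {H G : groupType} (SH : genset H) (SG : genset G).
Context (f : H -> G) (fM : {morph f : x y / (x * y)%g}) (f_inj : injective f).

(** A cover of [H] is carried to the image of [f]: the Lipschitz bound controls diameters,
    properness controls multiplicity. *)
Lemma asdim_at_most_mdim n :
  asdim_at_most (X := word_space R SH) n -> mdim_le SG (range f) n.
Proof.
move=> dH r; have [r' r'P] := inj_morph_wdist_proper SH SG fM f_inj (r + r).
have [K KP] := morph_wdist_le SH SG fM.
have [D [F [bd cov /multiplicityP ml]]] := dH r'.+1%:R%R (ltac:(by rewrite ltr0n)).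
have [D' DD'] : exists D' : nat, (D <= D'%:R)%R.
  exists (Num.bound `|D|); apply: le_trans (ler_norm D) (ltW _).
  exact/archi_boundP/normr_ge0.
pose inv_f g : word_space R SH := xget 1 [set h | f h = g].
have fK h : inv_f (f h) = h.
  by apply: f_inj; rewrite /inv_f; case: xgetP => [y _ //|/(_ h) []].
have covP h : exists U, F U /\ U h.
  by have : [set: word_space R SH] h by []; rewrite -cov => -[U FU Uh]; exists U.
pose lab g : set (word_space R SH) := xget set0 [set U | F U /\ U (inv_f g)].
have labP g : F (lab g) /\ lab g (inv_f g).
  exact: (@xgetPex _ set0 [set U | F U /\ U (inv_f g)] (covP _)).
exists (K * D')%N, (set (word_space R SH) : choiceType), lab; split.
  move=> _ _ [x _ <-] [y _ <-] xy; apply: leq_trans (KP x y) _.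
  rewrite leq_mul2l; apply/orP; right; rewrite -(ler_nat R).
  have [Fx Ux] := labP (f x); have [Fy Uy] := labP (f y).
  rewrite fK in Ux; rewrite fK -xy in Uy.
  exact: le_trans (le_diam (bd _ Fx) Ux Uy) DD'.
move=> z; pose B := [set h : word_space R SH | (wdist SG z (f h) <= r)%N].
have /ml/card_le_seq[s [sn sP]] : (diam B <= r'.+1%:R%:E)%E.
  apply: diam_le => x y Bx By; rewrite ler_nat leqW // r'P //.
  by apply: leq_trans (wdist_triangle SG z _ _) (leq_add _ By); rewrite wdistC.
exists s; split=> // _ [h _ <-] zh; apply: sP; have [Fh Uh] := labP (f h).
by split=> //; exists h; split=> //; rewrite fK in Uh.
Qed.

(** With [f] the identity this also changes the generating set. *)
Lemma mdim_asdim_at_most n :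
  mdim_le SG [set: G] n -> asdim_at_most (X := word_space R SH) n.
Proof.
move=> dG r r0; have [K KP] := morph_wdist_le SH SG fM.
have rb : (r <= (Num.bound r)%:R)%R by apply: ltW; apply: archi_boundP; exact: ltW.
have [D [I [lab [bd ml]]]] := dG (K * Num.bound r)%N.
have [D' D'P] := inj_morph_wdist_proper SH SG fM f_inj D.
pose U i : set (word_space R SH) := [set h | lab (f h) = i].
exists D'%:R%R, (range U); split.
- move=> _ [i _ <-]; apply: diam_le => x y xi yi; rewrite ler_nat D'P // bd //.
  by rewrite xi yi.
- apply/seteqP; split=> // x _; exists (U (lab (f x))) => //.
- apply/multiplicityP => B Br.
  case: (pselect (B !=set0)) => [[b Bb]|B0]; last first.
    apply: (@seq_card_le _ _ [::]) => // V [_ [x [_ Bx]]].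
    by case: B0; exists x.
  have [s [sn sP]] := ml (f b).
  apply: (@seq_card_le _ _ [seq U i | i <- s]); first by rewrite size_map.
  move=> _ [[i _ <-] [x [<- Bx]]]; apply: map_f; apply: sP => //.
  apply: leq_trans (KP b x) _; rewrite leq_mul2l; apply/orP; right.
  by rewrite -(ler_nat R); apply: le_trans rb; exact: (le_diam Br Bb Bx).
Qed.

End AsdimWordSpace.

Lemma asdim_fin_or_oo {R : realType} (X : metricType R) :
  asdim X = +oo%E \/ exists2 n, asdim_at_most (X := X) n & (n%:R%:E <= asdim X)%E.
Proof.
case: (pselect (exists n, `[< asdim_at_most (X := X) n >])) => [exn|nex]; [right|left].
  case: (ex_minnP exn) => n /asboolP dn min_n; exists n => //.
  apply: le_ereal_inf_tmp => _ [k dk <-]; rewrite lee_fin ler_nat.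
  by apply: min_n; apply/asboolP.
rewrite /asdim; set E := (X in ereal_inf X); suff -> : E = set0 by exact: ereal_inf0.
apply/seteqP; split=> // x [k dk _]; apply: nex; exists k; exact/asboolP.
Qed.

(** * Normal forms in HNN extensions *)

Section NormalForm.
Context {A : groupType} {P : pred A} {C : subGroupType P}.
Context (phi : {multiplicative C -> A}) (phi_inj : injective phi).
Implicit Types (a r : A) (c : C) (e : bool).

(* The two embeddings of C, exchanged by t: a word [emb e c * t^e] equals
   [t^e * emb (~~ e) c], where t^true = t and t^false = t^-1. *)
Definition emb e c : A := if e then val c else phi c.

Lemma embM e : {morph emb e : c d / c * d}.
Proof. by case: e => c d; exact: gmulfM. Qed.

Lemma emb1 e : emb e 1 = 1.
Proof. exact: morph_group1 (embM e). Qed.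

Lemma embV e c : emb e c^-1 = (emb e c)^-1.
Proof. exact: morph_groupV (embM e) c. Qed.

Definition emb_inv e a : C := xget 1 [set c | emb e c = a].

Lemma emb_inj e : injective (emb e).
Proof. by case: e; [exact: val_inj|exact: phi_inj]. Qed.

Lemma embK e : cancel (emb e) (emb_inv e).
Proof.
by move=> c; apply: (@emb_inj e); rewrite /emb_inv; case: xgetP => [d _ //|/(_ c) []].
Qed.

Definition in_emb e a : bool := `[< exists c, emb e c = a >].

Lemma in_embP e a : in_emb e a -> exists c, a = emb e c.
Proof. by move=> /asboolP[c <-]; exists c. Qed.

Lemma in_emb_emb e c : in_emb e (emb e c).
Proof. by apply/asboolP; exists c. Qed.

Lemma in_embMr e a c : in_emb e (a * emb e c) = in_emb e a.
Proof.
apply/asboolP/asboolP => -[d da]; last by exists (d * c); rewrite embM da.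
by exists (d * c^-1); rewrite embM embV da mulgK.
Qed.

Definition coset_rep e a : A := xget 1 [set b | in_emb e (b^-1 * a)].

Lemma coset_repP e a : exists c, a = coset_rep e a * emb e c.
Proof.
have /in_embP[c ac] : in_emb e ((coset_rep e a)^-1 * a).
  apply: (@xgetPex _ 1 [set b | in_emb e (b^-1 * a)]).
  by exists a; rewrite /= mulVg -(emb1 e) in_emb_emb.
by exists c; rewrite -ac mulVKg.
Qed.

(** [xget] depends only on the set it chooses from, which is here the coset of [a]. *)
Lemma coset_repMr e a c : coset_rep e (a * emb e c) = coset_rep e a.
Proof.
rewrite /coset_rep; congr (xget 1 _).
by apply/seteqP; split=> b /=; rewrite mulgA in_embMr.
Qed.

Lemma coset_rep_idem e a : coset_rep e (coset_rep e a) = coset_rep e a.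
Proof.
by have [c {2}->] := coset_repP e a; rewrite coset_repMr.
Qed.

Definition stack : Type := seq (A * bool).
Implicit Types (w v : stack) (s : stack * A).

(* The normal form (r_1 t^e_1) ... (r_k t^e_k) a is encoded as the state whose
   stack lists the pairs (r_i, e_i) with the last one on top; [t_act e] is right
   multiplication by t^e. *)
Definition t_push e s : stack * A :=
  let r := coset_rep e s.2 in
  ((r, e) :: s.1, emb (~~ e) (emb_inv e (r^-1 * s.2))).

Definition t_act e s : stack * A :=
  match s.1 with
  | (r, e') :: w => if (e' != e) && in_emb e s.2
                    then (w, r * emb (~~ e) (emb_inv e s.2)) else t_push e s
  | [::] => t_push e s
  end.

(** The last clause excludes the pinches t^-e c t^e of Britton's lemma. *)
Fixpoint reduced w : Prop :=
  match w with
  | [::] => True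
  | (r, e) :: w' => [/\ coset_rep e r = r, reduced w' &
      match w' with
      | (_, e') :: _ => e' != e -> ~~ in_emb e r
      | [::] => True
      end]
  end.

Lemma t_pushE e w r c : coset_rep e r = r ->
  t_push e (w, r * emb e c) = ((r, e) :: w, emb (~~ e) c).
Proof. by move=> rr; rewrite /t_push /= coset_repMr rr mulKg embK. Qed.

Variant t_act_spec e w : A -> stack * A -> Prop :=
| TPush r c of coset_rep e r = r & (reduced w -> reduced ((r, e) :: w)) :
    t_act_spec e w (r * emb e c) ((r, e) :: w, emb (~~ e) c)
| TPop r w' c of w = (r, ~~ e) :: w' :
    t_act_spec e w (emb e c) (w', r * emb (~~ e) c).

Lemma t_actP e w a : t_act_spec e w a (t_act e (w, a)).
Proof.
have pushP : (reduced w -> reduced ((coset_rep e a, e) :: w)) ->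
    t_act_spec e w a (t_push e (w, a)).
  have [c ac] := coset_repP e a; have := coset_rep_idem e a.
  move: ac; set r := coset_rep e a => -> rr red_r.
  by rewrite t_pushE //; constructor.
rewrite /t_act /=; case: w pushP => [|[r e'] w] pushP.
  by apply: pushP; split=> //; exact: coset_rep_idem.
case: ifP => [/andP[ee' /in_embP[c ->]]|nred].
  rewrite embK; clear pushP; have -> : e' = ~~ e by case: e e' ee' => -[].
  exact: TPop.
apply: pushP => red_w; split=> //; first exact: coset_rep_idem.
move=> ee'; move: nred; rewrite ee' /=; have [c ac] := coset_repP e a.
by rewrite [in X in X = _ -> _]ac in_embMr => ->.
Qed.

Lemma t_act_push e w r c : coset_rep e r = r -> reduced ((r, e) :: w) ->
  t_act e (w, r * emb e c) = ((r, e) :: w, emb (~~ e) c).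
Proof.
move=> rr [_ _]; rewrite /t_act /=; case: w => [|[r' e'] w]; first by rewrite t_pushE.
case: eqP => //= ee'; first by rewrite t_pushE.
by move=> /(_ isT); rewrite in_embMr => /negbTE ->; rewrite t_pushE.
Qed.

Lemma t_act_pop e w r c : t_act e ((r, ~~ e) :: w, emb e c) = (w, r * emb (~~ e) c).
Proof. by rewrite /t_act /= in_emb_emb embK; case: e. Qed.

Lemma t_act_reduced e s : reduced s.1 -> reduced (t_act e s).1.
Proof.
case: s => w a /=; case: t_actP => [r c _ red_r /red_r //|r w' c ->].
by case.
Qed.

(** Undoing a pop must push the same pair back; [reduced] provides the chosen representative and the
    absence of a pinch that this takes. *)
Lemma t_actK e s : reduced s.1 -> t_act (~~ e) (t_act e s) = s.
Proof.
case: s => w a /=; case: t_actP => [r c _ _ _|r w' c -> red_w].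
  by have := t_act_pop (~~ e) w r c; rewrite negbK.
have [rr _ _] := red_w.
by rewrite t_act_push // negbK.
Qed.

Lemma t_act_emb e w a c :
  t_act e (w, a * emb e c) = ((t_act e (w, a)).1, (t_act e (w, a)).2 * emb (~~ e) c).
Proof.
have pushM : t_push e (w, a * emb e c) =
    ((t_push e (w, a)).1, (t_push e (w, a)).2 * emb (~~ e) c).
  have [d ad] := coset_repP e a; have rr := coset_rep_idem e a.
  by rewrite ad -mulgA -embM !t_pushE //= embM.
rewrite /t_act /=; case: w pushM => // -[r e'] w pushM.
rewrite in_embMr; case: ifP => // /andP[_ /in_embP[d ->]] /=.
by rewrite -embM !embK embM mulgA.
Qed.

Definition letter_act s (l : option A * bool) : stack * A :=
  match l with
  | (Some a, b) => (s.1, s.2 * (if b then a^-1 else a))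
  | (None, b) => t_act (~~ b) s
  end.

Definition word_act s (u : fword (option A)) := foldl letter_act s u.

Lemma word_act_reduced s u : reduced s.1 -> reduced (word_act s u).1.
Proof.
elim: u s => //= -[[a|] b] u IH s red_s; apply: IH => //.
exact: t_act_reduced.
Qed.

(** Van der Waerden's trick: the group acts on the reduced states, so normal forms do not depend on
    the word. *)
Lemma word_act_pres (u u' : fword (option A)) : pres_eq (hnn_rel phi) u u' ->
  forall s, reduced s.1 -> word_act s u = word_act s u'.
Proof.
elim=> [//|u1 u2 _ IH s red_s|u1 u2 u3 _ IH1 _ IH2 s red_s
       |u1 u2 u3 u4 _ IH1 _ IH2 s red_s|[[a|] b] s red_s|_ _ [a b|c] s red_s].
- by rewrite IH.
- by rewrite IH1 ?IH2.
- rewrite /word_act !foldl_cat -!/(word_act _ _) IH1 // IH2 //.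
  exact: word_act_reduced.
- by case: s {red_s} => w x /=; case: b; rewrite /= ?mulgK ?mulgVK.
- by rewrite /= t_actK.
- by rewrite /= mulgA.
- rewrite /=; case E : (t_act _ s) => [w a] /=; have -> : val c = emb true c by [].
  by rewrite t_act_emb /= -E (t_actK false red_s).
Qed.

Notation G := (hnn phi).

Definition nform (g : G) : stack * A := word_act ([::], 1) (wrepr g).
Definition stk (g : G) : stack := (nform g).1.

Definition tpow e : G := if e then hnn_stable phi else (hnn_stable phi)^-1.

Fixpoint stack_val w : G :=
  if w is (r, e) :: w' then stack_val w' * hnn_base phi r * tpow e else 1.

Definition state_val s : G := stack_val s.1 * hnn_base phi s.2.

Lemma tpowV e : (tpow e)^-1 = tpow (~~ e).
Proof. by case: e; rewrite /= ?invgK. Qed.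

Lemma emb_tpow e c : hnn_base phi (emb e c) * tpow e = tpow e * hnn_base phi (emb (~~ e) c).
Proof.
by case: e => /=; rewrite -hnn_conj ?mulgK // -mulgA mulVKg.
Qed.

Lemma t_act_val e s : state_val (t_act e s) = state_val s * tpow e.
Proof.
case: s => w a; case: t_actP => [r c _ _|r w' c ->]; rewrite /state_val /=.
  by rewrite hnn_baseM -!mulgA emb_tpow.
by rewrite hnn_baseM -!mulgA emb_tpow -tpowV mulKg.
Qed.

Lemma letter_act_val s l : state_val (letter_act s l) = state_val s * wclass _ [:: l].
Proof.
case: l => -[a|] b /=.
  rewrite /state_val /= hnn_baseM mulgA; congr (_ * _).
  by case: b => //; rewrite hnn_baseV [LHS]wclassV.
rewrite t_act_val; congr (_ * _); case: b => //=.
by rewrite [LHS]wclassV.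
Qed.

Lemma word_act_val s u : state_val (word_act s u) = state_val s * wclass _ u.
Proof.
elim: u s => [|l u IH] s /=; first by rewrite wclass1 mulg1.
by rewrite IH letter_act_val -mulgA -[l :: u]cat1s -wclassM.
Qed.

Lemma nformK g : state_val (nform g) = g.
Proof. by rewrite word_act_val /state_val /= hnn_base1 !mul1g wreprK. Qed.

Lemma nformM g u : nform (g * wclass _ u) = word_act (nform g) u.
Proof.
rewrite -{1}(wreprK g) wclassM /nform.
rewrite (word_act_pres (wrepr_class _ _)) //.
by rewrite /word_act foldl_cat.
Qed.

Lemma nform_base g a : nform (g * hnn_base phi a) = ((nform g).1, (nform g).2 * a).
Proof. exact: nformM. Qed.

Lemma nform_tpow g e : nform (g * tpow e) = t_act e (nform g).
Proof.
have -> : tpow e = wclass _ [:: (None, ~~ e)] by case: e => //=; rewrite wclassV.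
by rewrite nformM /= negbK.
Qed.

Lemma nform1 : nform 1 = ([::], 1).
Proof. exact: (word_act_pres (wrepr_class (hnn_rel phi) [::]) (s := ([::], 1)) I). Qed.

Lemma stk1 : stk 1 = [::].
Proof. by rewrite /stk nform1. Qed.

Lemma hnn_base_inj : injective (hnn_base phi).
Proof.
move=> a b ab; have := nform_base 1 a; rewrite ab nform_base nform1 !mul1g.
by case.
Qed.

Lemma stk_base g a : stk (g * hnn_base phi a) = stk g.
Proof. by rewrite /stk nform_base. Qed.

Lemma nform_stkE g : g = stack_val (stk g) * hnn_base phi (nform g).2.
Proof. by rewrite -[LHS]nformK. Qed.

Lemma stack_val_cat w v : stack_val (w ++ v) = stack_val v * stack_val w.
Proof. by elim: w => [|[r e] w IH] /=; rewrite ?mulg1 // IH !mulgA. Qed.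

Lemma size_stk_tpow g e : (size (stk (g * tpow e)) <= (size (stk g)).+1)%N.
Proof.
rewrite /stk nform_tpow; case: (nform g) => w a; case: t_actP => //= r w' c -> /=.
by rewrite leqW // leqW.
Qed.

(** Each factor t^e raises the height by at most one, also when [w] is unreduced. *)
Lemma size_stk_stack_val w a : (size (stk (stack_val w * hnn_base phi a)) <= size w)%N.
Proof.
rewrite stk_base; elim: w => [|[r e] w IH] /=; first by rewrite stk1.
by apply: leq_trans (size_stk_tpow _ _) _; rewrite stk_base ltnS.
Qed.

End NormalForm.

(** * The Bass-Serre tree *)

(** In the tree: the ancestors of a vertex form a chain. *)
Lemma suffix_comparable (T : eqType) (u v w : seq T) :
  suffix u w -> suffix v w -> (size u <= size v)%N -> suffix u v.
Proof.
move=> uw vw uv; have vw' := size_suffix vw; move: uw vw.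
rewrite !suffixE => /eqP uE /eqP vE; apply/eqP.
rewrite -[X in drop _ X = _]vE drop_drop -[RHS]uE.
by congr (drop _ w); lia.
Qed.

(* The stack of x names the vertex xA, and [suffix v (stk x)] says that this vertex
   lies in the subtree hanging from the vertex v; the root is [::]. *)
Section TreeGeometry.
Context {A : groupType} {P : pred A} {C : subGroupType P}.
Context (phi : {multiplicative C -> A}) (phi_inj : injective phi).
Context (SA : genset A).
Notation G := (hnn phi).
Notation S := (hnn_genset phi SA).
Notation d := (wdist S).
Notation base := (hnn_base phi).
Implicit Types (x y z : G) (v w : stack (A := A)).

Lemma hnn_letterP (s : G) : is_letter S s ->
  (exists a, s = base a) \/ (exists e, s = tpow phi e).
Proof.
rewrite /is_letter /= !inE => /orP[]/orP[].
- by move=> /eqP ->; right; exists true.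
- by move=> /mapP[a _ ->]; left; exists a.
- by move=> /eqP se; right; exists false; rewrite /= -se invgK.
- by move=> /mapP[a _ sa]; left; exists a^-1; rewrite hnn_baseV -sa invgK.
Qed.

Lemma word_length_tpow e : (word_length S (tpow phi e) <= 1)%N.
Proof.
apply: word_length_letter; rewrite /is_letter /= !inE.
by case: e => /=; rewrite ?invgK eqxx ?orbT.
Qed.

Lemma size_stk_letter x s : is_letter S s -> (size (stk (x * s)) <= (size (stk x)).+1)%N.
Proof.
case/hnn_letterP => [[a ->]|[e ->]]; first by rewrite stk_base // leqW.
exact: size_stk_tpow.
Qed.

Lemma size_stk_lip x y : (size (stk y) <= size (stk x) + d x y)%N.
Proof.
have [k] := ubnP (d x y); elim: k x y => // k IH x y xyk.
have [->|xy] := eqVneq x y; first by rewrite wdistxx addn0.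
have [z [s [Ss yE xz]]] := wdist_step S xy.
have := size_stk_letter z Ss; rewrite -yE; have := IH x z; lia.
Qed.

(* The edge above v is the coset of C based at [edge_base v]: on the side of v it
   reads as a coset of phi C when the last letter is t, and t (phi C) t^-1 = C. *)
Definition edge_base v : G :=
  stack_val phi v * (if v is (_, true) :: _ then tpow phi false else 1).

(** Letters of [A] keep the stack and a push extends it, so only a pop can leave the subtree, and it
    must remove the top pair of [v]. *)
Lemma crossing v x s : is_letter S s ->
  suffix v (stk x) -> ~~ suffix v (stk (x * s)) ->
  stk (x * s) = behead v /\
  exists c : C, (d (x * s) (edge_base v * base (val c)) <= 1)%N.
Proof.
case/hnn_letterP => [[a ->] vx|[e ->]].
  by rewrite stk_base // vx.
rewrite /stk nform_tpow //; have := nform_stkE phi_inj x; rewrite /stk.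
case: (nform x) => w a /=; case: t_actP => //= [r c _ _ _ vw|r w' c -> xE vw vw'].
  by rewrite -cat1s suffix_catr.
case/suffixP: vw => -[|b u] /= vE; last first.
  by case: vE => _ w'E; move: vw'; rewrite w'E suffix_suffix.
rewrite -vE; split=> //=; exists c; rewrite xE /edge_base /=.
(* If [e] is true, the removed letter is t^-1 and the coset is one step away; otherwise the new
   point lies on the coset. *)
case: e {xE vE vw'} => /=.
  by rewrite mulg1 wdistC wdist_mulr (word_length_tpow true).
by rewrite -!mulgA [X in _ * (_ * (_ * X))](emb_tpow phi false c) wdistxx.
Qed.

(* A point outside the subtree of v at minimal distance from x (junk if v = [::]). *)
Definition outp v x : G := xget 1
  [set y | ~~ suffix v (stk y) /\ forall z, ~~ suffix v (stk z) -> (d x y <= d x z)%N].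

Definition delta v x := d x (outp v x).

Lemma outpP v x : v != [::] -> ~~ suffix v (stk (outp v x)) /\
  forall z, ~~ suffix v (stk z) -> (delta v x <= d x z)%N.
Proof.
move=> v0.
apply: (@xgetPex _ 1
  [set y | ~~ suffix v (stk y) /\ forall z, ~~ suffix v (stk z) -> (d x y <= d x z)%N]).
have ex1 : exists k, `[< exists y, ~~ suffix v (stk y) /\ d x y = k >].
  exists (d x 1); apply/asboolP; exists 1; split=> //.
  by rewrite stk1 // suffixs0.
case: (ex_minnP ex1) => k /asboolP[y [vy <-]] min_k; exists y; split=> // z vz.
by apply: min_k; apply/asboolP; exists z.
Qed.

Lemma delta_le v x z : v != [::] -> ~~ suffix v (stk z) -> (delta v x <= d x z)%N.
Proof. by move=> v0; apply: (outpP x v0).2. Qed.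

Lemma delta_lip v x y : v != [::] -> (delta v x <= d x y + delta v y)%N.
Proof.
move=> v0; apply: leq_trans (wdist_triangle _ y _ _).
exact: delta_le (outpP y v0).1.
Qed.

Lemma delta_gt v x y : v != [::] -> (d x y < delta v x)%N -> suffix v (stk y).
Proof. by move=> v0; apply: contraTT => /(delta_le x v0); rewrite -leqNgt. Qed.

(** By minimality, the last step of a geodesic from [x] to [outp v x] crosses the edge above [v]. *)
Lemma outp_edge v x : v != [::] -> suffix v (stk x) ->
  stk (outp v x) = behead v /\
  exists c : C, (d (outp v x) (edge_base v * base (val c)) <= 1)%N.
Proof.
move=> v0 vx; have [vo min_o] := outpP x v0.
have xo : x != outp v x by apply: contraNneq vo => <-.
have [z [s [Ss oE xz]]] := wdist_step S xo.
have vz : suffix v (stk z).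
  by apply: contraTT xz => /min_o; rewrite -leqNgt.
by rewrite oE; apply: crossing => //; rewrite -oE.
Qed.

(** The nearest outside point has height [size v - 1], and height is 1-Lipschitz. *)
Lemma delta_size v x : v != [::] -> suffix v (stk x) ->
  (size (stk x) < size v + delta v x)%N.
Proof.
move=> v0 vx; have [oE _] := outp_edge v0 vx.
have := size_stk_lip (outp v x) x; rewrite oE size_behead wdistC -/(delta v x).
by case: v v0 {vx oE} => //= ? ? _; lia.
Qed.

(** Pieces are translated back to the root, so that one labelling of the points of bounded height
    serves them all. *)
Lemma size_stk_translate x w u : stk x = w ++ u ->
  (size (stk ((stack_val phi u)^-1 * x)) <= size w)%N.
Proof.
move=> xE; rewrite [x in X in (X <= _)%N](nform_stkE phi_inj) xE stack_val_cat.
by rewrite -!mulgA mulKg size_stk_stack_val.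
Qed.

End TreeGeometry.

(** * Gluing *)

(** Room for [2 * N] thresholds, two per colour, spaced by [4 * r + 1], and one further such
    interval as a margin. *)
Definition collar_width r N := ((N + N).+1 * (4 * r).+1)%N.

Section Gluing.
Context {A : groupType} {P : pred A} {C : subGroupType P}.
Context (phi : {multiplicative C -> A}) (phi_inj : injective phi).
Context (SA : genset A) (r N m : nat).
Notation G := (hnn phi).
Notation S := (hnn_genset phi SA).
Notation d := (wdist S).
Notation base := (hnn_base phi).
Notation stack := (seq (A * bool)).
Notation rho := (collar_width r N).
Notation q := (4 * r).+1.
Implicit Types (x y z : G) (u v w : stack).

(* [kappa h] is the height of the last cut edge on a path of length h from the root
   (0 if there is none). *)
Context (kappa : nat -> nat).
Hypothesis kappa_le : forall h, (kappa h <= h)%N.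
Hypothesis kappa_mono : {homo kappa : h k / (h <= k)%N}.
Hypothesis kappa_idem : forall h, kappa (kappa h) = kappa h.
(** A point within [4 * r] of the upper end of a cut edge thus lies beyond the collar of the
    previous cut edge. *)
Hypothesis kappa_gap : forall h k, (0 < kappa h)%N -> (kappa h < kappa k)%N ->
  (kappa h + (rho + 4 * r).+1 <= kappa k)%N.

Context (J : nat -> Prop).
Hypothesis J_down : forall h k, (h <= k)%N -> J k -> J h.
Hypothesis J_kappa : forall h, J h -> (h <= kappa h + m)%N.

Let Y : set G := [set x | J (size (stk x))].

Context (DC : nat) (IC : choiceType) (colC : G -> nat) (labC : G -> IC).
(** The extra one is the distance from [outp] to the edge coset in [outp_edge]. *)
Let NC := nbhd S rho.+1 (range (base \o (val : C -> A))).
Hypothesis colC_lt : forall x, NC x -> (colC x < N)%N.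
Hypothesis labC_bounded : bounded_labelling S NC DC (fun x => (colC x, labC x)).
Hypothesis labC_sep : forall x y, NC x -> NC y -> colC x = colC y ->
  (d x y <= r + r)%N -> labC x = labC y.

Context (DL : nat) (IL : choiceType) (lam : G -> IL).
Let Gm : set G := [set x | (size (stk x) <= m)%N].
Hypothesis lam_bounded : bounded_labelling S Gm DL lam.
Hypothesis lam_mult : ball_meets_labels S Gm (r + (DC + rho)) N.+1 lam.

Definition trunc w : stack := drop (size w - kappa (size w)) w.

Lemma size_trunc w : size (trunc w) = kappa (size w).
Proof. by rewrite size_drop subKn // kappa_le. Qed.

Lemma suffix_trunc w : suffix (trunc w) w.
Proof. exact: suffix_drop. Qed.

Lemma trunc_max v w : kappa (size v) = size v -> suffix v w -> suffix v (trunc w).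
Proof.
move=> kv vw; apply: (suffix_comparable vw (suffix_trunc w)).
by rewrite size_trunc -kv; apply/kappa_mono/size_suffix.
Qed.

Lemma kappa_trunc w : kappa (size (trunc w)) = size (trunc w).
Proof. by rewrite size_trunc kappa_idem. Qed.

Definition piece x : stack := trunc (stk x).

Definition parent v : stack := trunc (behead v).

Definition kcol v x := colC ((edge_base phi v)^-1 * x).
Definition klab v x := labC ((edge_base phi v)^-1 * x).

Definition collar v x := [/\ Y x, piece x = v & (delta SA v x <= rho)%N].

Definition kpoint v (j : nat) (i : IC) : G :=
  xget 1 [set y | [/\ collar v y, kcol v y = j & klab v y = i]].

Definition label : choiceType := ((stack * (nat * IC)) + (stack * IL))%type.

Definition piece_label u x : label := inr (u, lam ((stack_val phi u)^-1 * x)).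

Definition phase (j h : nat) : nat := ((j.+1 * q < h) + ((N + j).+1 * q < h))%N.

(* The piece above in phase 0, the collar in phase 1, the piece below in phase 2.
   In the outer phases the label depends only on the collar set (v, j, i), which is
   moved into the piece as a whole through one of its points. *)
Definition collar_label v j i (p : nat) : label :=
  match p with
  | 0 => piece_label (parent v) (outp SA v (kpoint v j i))
  | 1 => inl (v, (j, i))
  | _ => piece_label v (kpoint v j i)
  end.

Definition glued_label x : label :=
  let v := piece x in
  if (v == [::]) || (rho < delta SA v x)%N then piece_label v x
  else collar_label v (kcol v x) (klab v x) (phase (kcol v x) (delta SA v x)).

(** Such an [x] borrows the label of a nearby point of the piece [u]; a ball anchored in a single
    piece inherits the multiplicity of [lam]. *)
Definition anchored u x := exists y,
  [/\ Y y, piece y = u, (d x y <= DC + rho)%N & glued_label x = piece_label u y].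

Lemma suffix_piece x : suffix (piece x) (stk x).
Proof. exact: suffix_trunc. Qed.

Lemma size_piece x : size (piece x) = kappa (size (stk x)).
Proof. exact: size_trunc. Qed.

Lemma piece_translate x : Y x -> Gm ((stack_val phi (piece x))^-1 * x).
Proof.
move=> Yx; have /suffixP[w wE] := suffix_piece x.
rewrite /Gm /=; apply: leq_trans (size_stk_translate phi_inj wE) _.
have := J_kappa Yx; rewrite -size_piece.
have -> : size (stk x) = (size w + size (piece x))%N by rewrite {1}wE size_cat.
by rewrite addnC leq_add2l.
Qed.

Lemma collar_suffix v x : collar v x -> suffix v (stk x).
Proof. by case=> _ <- _; exact: suffix_piece. Qed.

Lemma collar_nbhd v x : v != [::] -> collar v x -> NC ((edge_base phi v)^-1 * x).
Proof.
move=> v0 vx; have [_ [c oc]] := outp_edge phi_inj SA v0 (collar_suffix vx).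
exists (base (val c)); first by exists c.
rewrite wdistMVl; apply: leq_trans (wdist_triangle _ (outp SA v x) _ _) _.
by rewrite -addn1 leq_add //; case: vx.
Qed.

Lemma kcol_lt v x : v != [::] -> collar v x -> (kcol v x < N)%N.
Proof. by move=> v0 vx; apply/colC_lt/collar_nbhd. Qed.

Lemma collar_dist v x y : v != [::] -> collar v x -> collar v y ->
  kcol v x = kcol v y -> klab v x = klab v y -> (d x y <= DC)%N.
Proof.
move=> v0 vx vy jj ii; rewrite -(wdistMl _ (edge_base phi v)^-1).
apply: labC_bounded; [exact: collar_nbhd|exact: collar_nbhd|].
by rewrite -!/(kcol _ _) -!/(klab _ _) jj ii.
Qed.

Lemma collar_klab v x y : v != [::] -> collar v x -> collar v y ->
  kcol v x = kcol v y -> (d x y <= r + r)%N -> klab v x = klab v y.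
Proof.
move=> v0 vx vy jj xy; apply: labC_sep => //; [exact: collar_nbhd|exact: collar_nbhd|].
by rewrite wdistMl.
Qed.

Lemma kpointP v x : v != [::] -> collar v x ->
  collar v (kpoint v (kcol v x) (klab v x)) /\
  (d x (kpoint v (kcol v x) (klab v x)) <= DC)%N.
Proof.
move=> v0 vx; have : [/\ collar v (kpoint v (kcol v x) (klab v x)),
    kcol v (kpoint v (kcol v x) (klab v x)) = kcol v x &
    klab v (kpoint v (kcol v x) (klab v x)) = klab v x].
  apply: (@xgetPex _ 1 [set y | [/\ collar v y, kcol v y = kcol v x & klab v y = klab v x]]).
  by exists x.
by move=> [vk jj ii]; split=> //; apply: (collar_dist v0).
Qed.

Lemma anchored_piece x : Y x -> piece x = [::] \/ (rho < delta SA (piece x) x)%N ->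
  anchored (piece x) x.
Proof.
move=> Yx far; exists x; split=> //; first by rewrite wdistxx.
by rewrite /glued_label; case: far => ->; rewrite ?eqxx ?orbT.
Qed.

Lemma glued_label_collar v x : v != [::] -> collar v x ->
  glued_label x = collar_label v (kcol v x) (klab v x) (phase (kcol v x) (delta SA v x)).
Proof.
by move=> v0 [Yx xv dx]; rewrite /glued_label xv (negbTE v0) ltnNge dx.
Qed.

Lemma anchored_parent v x : v != [::] -> collar v x ->
  phase (kcol v x) (delta SA v x) = 0%N -> anchored (parent v) x.
Proof.
move=> v0 vx ph; have [vk xk] := kpointP v0 vx.
move: vk xk (glued_label_collar v0 vx); rewrite ph /=; set k := kpoint _ _ _ => vk xk lx.
have [oE _] := outp_edge phi_inj SA v0 (collar_suffix vk).
exists (outp SA v k); split=> //.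
- have [Yk _ _] := vk; apply: J_down Yk; rewrite oE size_behead.
  by apply: leq_trans (leq_pred _) (size_suffix (collar_suffix vk)).
- by rewrite /piece oE.
- by apply: leq_trans (wdist_triangle _ k _ _) (leq_add xk _); case: vk.
Qed.

Lemma anchored_child v x : v != [::] -> collar v x ->
  (1 < phase (kcol v x) (delta SA v x))%N -> anchored v x.
Proof.
move=> v0 vx ph; have [vk xk] := kpointP v0 vx.
exists (kpoint v (kcol v x) (klab v x)); split.
- by case: vk.
- by case: vk.
- by apply: leq_trans xk (leq_addr _ _).
- by rewrite (glued_label_collar v0 vx); case: phase ph => [|[]].
Qed.

Lemma glued_labelP x : Y x -> (exists u, anchored u x) \/
  exists2 v, v != [::] /\ collar v x & glued_label x = inl (v, (kcol v x, klab v x)).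
Proof.
move=> Yx; have [x0|x0] := eqVneq (piece x) [::].
  by left; exists (piece x); apply: anchored_piece => //; left.
have [dx|dx] := ltnP rho (delta SA (piece x) x).
  by left; exists (piece x); apply: anchored_piece => //; right.
have vx : collar (piece x) x by [].
case ph : (phase (kcol (piece x) x) (delta SA (piece x) x)) => [|[|p]].
- by left; exists (parent (piece x)); apply: anchored_parent.
- by right; exists (piece x) => //; rewrite (glued_label_collar x0 vx) ph.
- by left; exists (piece x); apply: anchored_child; rewrite ?ph.
Qed.

Lemma glued_label_bounded : bounded_labelling S Y (DL + 2 * (DC + rho)) glued_label.
Proof.
move=> x y Yx Yy; case: (glued_labelP Yx) => [[u [x' [Yx' x'u xx' ->]]]|[v [v0 vx] ->]];
  case: (glued_labelP Yy) => [[u' [y' [Yy' y'u yy' ->]]]|[v' [v'0 vy] ->]] //.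
- move=> [uu ll]; have : (d x' y' <= DL)%N.
    rewrite -(wdistMl _ (stack_val phi u)^-1); apply: lam_bounded.
    + by rewrite -x'u; exact: piece_translate.
    + by rewrite uu -y'u; exact: piece_translate.
    + by rewrite ll uu.
  have := wdist_triangle S x' x y; have := wdist_triangle S y' x' y.
  by rewrite (wdistC S y' y); lia.
- move=> [vv jj ii]; rewrite -vv in vy jj ii.
  by apply: leq_trans (collar_dist v0 vx vy jj ii) _; lia.
Qed.

Lemma anchored_ball_labels u z :
  (forall y, Y y -> (d z y <= r)%N -> anchored u y) ->
  exists s : seq label, (size s <= N.+1)%N /\
    forall y, Y y -> (d z y <= r)%N -> glued_label y \in s.
Proof.
move=> anch; have [s [sN sP]] := lam_mult ((stack_val phi u)^-1 * z).
exists [seq inr (u, i) | i <- s]; split; first by rewrite size_map.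
move=> y Yy zy; have [y' [Yy' y'u yy' ->]] := anch y Yy zy.
apply: (map_f (fun i => inr (u, i))); apply: sP.
  by rewrite -y'u; exact: piece_translate.
by rewrite wdistMl; apply: leq_trans (wdist_triangle _ y _ _) (leq_add zy yy').
Qed.

(** * Arithmetic of the phases *)

Lemma phase_low j h : (h <= 4 * r)%N -> phase j h = 0%N.
Proof.
rewrite /phase => hr; have := leq_pmull q (ltn0Sn j).
have := leq_pmull q (ltn0Sn (N + j)); move: (_ * q)%N (_ * q)%N => a b; lia.
Qed.

(** All thresholds are at most [2 * N * q], which is [rho - q]. *)
Lemma phase_high j h : (j < N)%N -> (rho < h + (r + r))%N -> (1 < phase j h)%N.
Proof.
rewrite /phase /collar_width => jN.
have : (j.+1 * q <= (N + N) * q)%N by rewrite leq_mul2r; lia.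
have : ((N + j).+1 * q <= (N + N) * q)%N by rewrite leq_mul2r; lia.
rewrite (mulSn (N + N)); move: (_ * q)%N (_ * q)%N (_ * q)%N => a b c.
by case: ltnP; case: ltnP; lia.
Qed.

Lemma phase_jump j h e : (e <= h)%N -> phase j h != phase j e ->
  exists2 k, k = j.+1 \/ k = (N + j).+1 & (e <= k * q < h)%N.
Proof.
move=> eh ph; have [h1|h1] := boolP (e <= j.+1 * q < h)%N.
  by exists j.+1 => //; left.
exists (N + j).+1; first by right.
move: h1 ph; rewrite /phase; move: (_ * q)%N (_ * q)%N => a b.
by case: (ltnP a h); case: (ltnP b h); case: (ltnP a e); case: (ltnP b e) => //=; lia.
Qed.

(* The thresholds of different colours are more than 2 * r apart, so at most one
   colour changes phase within an interval of that length. *)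
Lemma phase_stable j0 h0 j h e : (j0 < N)%N -> (j < N)%N -> j != j0 ->
  (e <= h0 <= e + (r + r))%N -> (e <= h <= e + (r + r))%N ->
  phase j0 h0 != phase j0 e -> phase j h = phase j e.
Proof.
move=> j0N jN jj0 /andP[eh0 h0e] /andP[eh he] /(phase_jump eh0)[k kE kq].
apply/eqP; apply: contraT => /(phase_jump eh)[k' k'E k'q].
have : k != k' by apply/eqP; lia.
rewrite neq_ltn => /orP[]; rewrite -(leq_pmul2r (ltn0Sn (4 * r))) mulSn;
  move: (_ * q)%N (_ * q)%N kq k'q => a b; lia.
Qed.

(** The two thresholds of one colour are at least [q] apart, so the interval contains at most one of
    them. *)
Lemma phase_two_values j h0 h e : (j < N)%N ->
  (e <= h0 <= e + (r + r))%N -> (e <= h <= e + (r + r))%N ->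
  phase j h0 != phase j e -> phase j h != phase j e -> phase j h = phase j h0.
Proof.
move=> jN; have : (j.+1 * q + q <= (N + j).+1 * q)%N by rewrite -mulSnr leq_mul2r; lia.
rewrite /phase; move: (_ * q)%N (_ * q)%N => a b.
by case: (ltnP a h0); case: (ltnP b h0); case: (ltnP a e); case: (ltnP b e);
  case: (ltnP a h); case: (ltnP b h) => //=; lia.
Qed.

(** Depths in the ball differ by at most [2 * r], so every point is beyond the collar or in its last
    phase. *)
Lemma anchored_far v z : v != [::] ->
  (forall y, Y y -> (d z y <= r)%N -> piece y = v) ->
  forall x, Y x -> (d z x <= r)%N -> (rho < delta SA v x)%N ->
  forall y, Y y -> (d z y <= r)%N -> anchored v y.
Proof.
move=> v0 same x Yx zx dx y Yy zy; have yv := same y Yy zy.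
have [dy|dy] := ltnP rho (delta SA v y).
  by have := @anchored_piece y Yy; rewrite yv; apply; right.
have vy : collar v y by [].
apply: anchored_child => //; apply: phase_high; first exact: kcol_lt.
apply: leq_trans dx _; apply: leq_trans (delta_lip phi_inj SA x y v0) _.
rewrite addnC leq_add2l; apply: leq_trans (wdist_triangle _ z _ _) _.
by rewrite leq_add // wdistC.
Qed.

(** Each colour contributes its label at the minimal depth of the ball; the one colour that may
    change phase adds a single further label. *)
Lemma collar_ball_labels v z : v != [::] ->
  (forall y, Y y -> (d z y <= r)%N -> collar v y) ->
  exists s : seq label, (size s <= N.+1)%N /\
    forall y, Y y -> (d z y <= r)%N -> glued_label y \in s.
Proof.
move=> v0 col; pose B := [set y | Y y /\ (d z y <= r)%N].
case: (pselect (B !=set0)) => [[x0 Bx0]|B0]; last first.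
  by exists [::]; split=> // y Yy zy; case: B0; exists y.
have dB x y : B x -> B y -> (d x y <= r + r)%N.
  move=> [_ zx] [_ zy]; apply: leq_trans (wdist_triangle _ z _ _) _.
  by rewrite leq_add // wdistC.
have [e [x1 Bx1 x1e] min_e] : exists2 e, (exists2 x, B x & delta SA v x = e) &
    forall y, B y -> (e <= delta SA v y)%N.
  have ex1 : exists e, `[< exists2 x, B x & delta SA v x = e >].
    by exists (delta SA v x0); apply/asboolP; exists x0.
  case: (ex_minnP ex1) => e /asboolP ee min_e; exists e => // y By.
  by apply: min_e; apply/asboolP; exists y.
have rangeB y : B y -> (e <= delta SA v y <= e + (r + r))%N.
  move=> By; rewrite min_e //= -x1e addnC.
  apply: leq_trans (delta_lip phi_inj SA y x1 v0) _.
  by rewrite leq_add2r dB.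
(* Points of one colour in the ball are within [2 * r], hence share their collar set; the default
   only serves absent colours. *)
pose lab_of j := xget (klab v x0) [set i | exists y, [/\ B y, kcol v y = j & klab v y = i]].
have lab_ofP y : B y -> lab_of (kcol v y) = klab v y.
  move=> By; have [y' [By' jj <-]] : exists y', [/\ B y', kcol v y' = kcol v y &
      klab v y' = lab_of (kcol v y)].
    by apply: (@xgetPex _ (klab v x0) [set i | exists y', [/\ B y',
      kcol v y' = kcol v y & klab v y' = i]]); exists (klab v y), y.
  have [Yy zy] := By; have [Yy' zy'] := By'.
  by apply: (collar_klab v0) => //; [exact: col|exact: col|exact: dB].
pose lbl j p := collar_label v j (lab_of j) p.
have labE y : B y -> glued_label y = lbl (kcol v y) (phase (kcol v y) (delta SA v y)).
  move=> By; rewrite /lbl lab_ofP //; apply: glued_label_collar => //.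
  by case: By => Yy zy; apply: col.
have colN y : B y -> (kcol v y < N)%N.
  by move=> [Yy zy]; apply: kcol_lt => //; apply: col.
pose s0 := [seq lbl j (phase j e) | j <- iota 0 N].
have s0P y : B y -> phase (kcol v y) (delta SA v y) = phase (kcol v y) e ->
    glued_label y \in s0.
  move=> By ph; rewrite labE // ph; apply: (map_f (fun j => lbl j (phase j e))).
  by rewrite mem_iota /= add0n colN.
case: (pselect (exists2 y, B y &
    phase (kcol v y) (delta SA v y) != phase (kcol v y) e)) => [[y0 By0 ph0]|stable].
  exists (glued_label y0 :: s0); split; first by rewrite /= size_map size_iota.
  move=> y Yy zy; have By : B y by [].
  rewrite inE; have [phy|phy] := eqVneq (phase (kcol v y) (delta SA v y)) (phase (kcol v y) e).
    by rewrite s0P ?orbT.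
  have [jj|jj] := eqVneq (kcol v y) (kcol v y0); last first.
    have := phase_stable (colN _ By0) (colN _ By) jj (rangeB _ By0) (rangeB _ By) ph0.
    by move/eqP: phy.
  have := phase_two_values (colN _ By0) (rangeB _ By0) _ ph0; rewrite -jj => ph2.
  by rewrite !labE // jj in phy ph2 *; rewrite (ph2 _ (rangeB _ By) phy) eqxx.
exists s0; split; first by rewrite size_map size_iota.
move=> y Yy zy; have By : B y by [].
by apply: s0P => //; apply/eqP; apply: contraT => ph; case: stable; exists y.
Qed.

(* A ball which leaves the subtree of a cut vertex is so close to that edge that,
   even in the collars of the sibling vertices it may meet, only phase 0 occurs. *)
Lemma anchored_crossing z x x' : Y x -> Y x' -> (d z x <= r)%N -> (d z x' <= r)%N ->
  ~~ suffix (piece x) (stk x') ->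
  forall y, Y y -> (d z y <= r)%N -> anchored (parent (piece x)) y.
Proof.
move=> Yx Yx' zx zx' xx' y Yy zy; set v := piece x in xx' *.
have v0 : v != [::] by apply: contraNneq xx' => ->; rewrite suffix0s.
have vx : suffix v (stk x) by exact: suffix_piece.
have near a b : (d z a <= r)%N -> (d z b <= r)%N -> (d a b <= r + r)%N.
  move=> za zb; apply: leq_trans (wdist_triangle _ z _ _) _.
  by rewrite leq_add // wdistC.
have [oE _] := outp_edge phi_inj SA v0 vx; set o := outp SA v x in oE.
have oy : (d o y <= 4 * r)%N.
  have xo : (d x o <= r + r)%N.
    by apply: leq_trans (delta_le phi_inj SA x v0 xx') (near _ _ zx zx').
  have := wdist_triangle S x o y; have := near _ _ zx zy; rewrite (wdistC _ o x); lia.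
have size_o : (size (stk o)).+1 = size v by rewrite oE size_behead; case: (v) v0.
have size_y : (size (stk y) <= size (stk o) + 4 * r)%N.
  by apply: leq_trans (size_stk_lip phi_inj SA o y) _; rewrite leq_add2l.
set u := parent v; have size_u : size u = kappa (size (stk o)).
  by rewrite size_trunc oE.
have kv : kappa (size v) = size v by rewrite size_trunc kappa_idem.
have ku : kappa (size u) = size u by rewrite size_u kappa_idem.
have uv : (size u < size v)%N by rewrite -size_o ltnS size_u kappa_le.
have uo : suffix u (stk o) by rewrite oE suffix_trunc.
have far : u != [::] -> suffix u (stk y) /\ (rho < delta SA u y)%N.
  move=> u0; have u_gt0 : (0 < size u)%N by case: (u) u0.
  have gap : (size u + (rho + 4 * r).+1 <= size v)%N.
    by rewrite -ku -kv kappa_gap // ?ku ?kv.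
  have := delta_size phi_inj SA u0 uo => od.
  have dy : (rho < delta SA u y)%N.
    have := delta_lip phi_inj SA o y u0; lia.
  split=> //; apply: (delta_gt phi_inj (SA := SA) u0 (x := o)); lia.
have uy : suffix u (stk y) by have [->|/far[]//] := eqVneq u [::]; exact: suffix0s.
have u_piece : suffix u (piece y) by exact: trunc_max.
have [yu|yu] := eqVneq (piece y) u.
  rewrite -yu; apply: anchored_piece => //; rewrite yu.
  by have [->|/far[_]] := eqVneq u [::]; [left|right].
have lt_u : (size u < size (piece y))%N.
  rewrite ltn_neqAle size_suffix // andbT; apply: contraNneq yu => uE.
  by move: u_piece; rewrite suffixE uE subnn drop0.
have ky : kappa (size (piece y)) = size (piece y) by rewrite size_piece kappa_idem.
(* The root of the piece of [y] is not higher than [v] by monotonicity of [kappa], nor deeper by the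
   gap, as [y] is too close to [o]. *)
have size_yv : size (piece y) = size v.
  apply/eqP; rewrite eqn_leq; apply/andP; split; last first.
    rewrite leqNgt; apply/negP => yv; move: lt_u; rewrite ltnNge size_u -ky.
    by rewrite kappa_mono // -ltnS size_o.
  rewrite leqNgt; apply/negP => vy.
  have := kappa_gap (h := size v) (k := size (piece y)); rewrite kv ky => /(_ _ vy).
  have := kappa_le (size (stk y)); rewrite -size_piece; lia.
(* Being shorter than [v'], the stack of [o] is outside its subtree, so [y] has depth at most
   [4 * r], before every threshold. *)
set v' := piece y; have v'0 : v' != [::] by rewrite -size_eq0 size_yv -size_o.
have oy' : (delta SA v' y <= 4 * r)%N.
  apply: leq_trans oy; rewrite wdistC; apply: delta_le => //.
  by apply/negP => /size_suffix; rewrite size_yv -size_o ltnn.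
have v'y : collar v' y.
  by split=> //; apply: leq_trans oy' (leq_trans (leqnSn _) (leq_pmull _ _)).
have -> : u = parent v'.
  have puv : suffix (parent v') v'.
    apply: (suffix_trans (suffix_trunc _)); apply/suffixP; exists (take 1 v').
    by case: (v') => //= l s; rewrite take0.
  have su : size (parent v') = size u.
    by rewrite size_u size_trunc size_behead size_yv oE size_behead.
  have := suffix_comparable u_piece puv; rewrite su leqnn => /(_ isT).
  by rewrite suffixE su subnn drop0 => /eqP.
by apply: anchored_parent => //; apply: phase_low.
Qed.

(** A ball crosses a cut edge or lies in one piece; in the latter case the piece is the root piece,
    or the ball has a point beyond the collar, or it lies inside the collar. *)
Lemma glued_label_mult : ball_meets_labels S Y r N.+1 glued_label.
Proof.
move=> z; case: (pselect (exists x x', [/\ Y x, Y x', (d z x <= r)%N,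
    (d z x' <= r)%N & ~~ suffix (piece x) (stk x')])).
  move=> [x [x' [Yx Yx' zx zx' xx']]].
  exact: anchored_ball_labels (anchored_crossing Yx Yx' zx zx' xx').
move=> nocross.
case: (pselect (exists x, Y x /\ (d z x <= r)%N)) => [[x [Yx zx]]|empty]; last first.
  by exists [::]; split=> // y Yy zy; case: empty; exists y.
have sub a b : Y a -> Y b -> (d z a <= r)%N -> (d z b <= r)%N -> suffix (piece a) (piece b).
  move=> Ya Yb za zb; apply: trunc_max; first exact: kappa_trunc.
  by apply: contraT => ab; case: nocross; exists a, b.
have same y : Y y -> (d z y <= r)%N -> piece y = piece x.
  move=> Yy zy; have xy := sub _ _ Yx Yy zx zy; have yx := sub _ _ Yy Yx zy zx.
  have sE : size (piece y) = size (piece x) by apply/eqP; rewrite eqn_leq !size_suffix.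
  by move: yx; rewrite suffixE sE subnn drop0 => /eqP.
have [x0|x0] := eqVneq (piece x) [::].
  apply: (@anchored_ball_labels [::]) => y Yy zy; have := @anchored_piece y Yy.
  by rewrite same // x0; apply; left.
case: (pselect (exists y, [/\ Y y, (d z y <= r)%N & (rho < delta SA (piece x) y)%N])).
  move=> [y [Yy zy dy]]; exact: anchored_ball_labels (anchored_far x0 same Yy zy dy).
move=> nofar; apply: (collar_ball_labels x0) => y Yy zy; split=> //; first exact: same.
by rewrite leqNgt; apply/negP => dy; apply: nofar; exists y.
Qed.

End Gluing.

(** * Dimension of the HNN extension *)

Section HNNDimension.
Context {A : groupType} {P : pred A} {C : subGroupType P}.
Context (phi : {multiplicative C -> A}) (phi_inj : injective phi).
Context (SA : genset A) (N : nat).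
Notation G := (hnn phi).
Notation S := (hnn_genset phi SA).
Notation base := (hnn_base phi).
Hypothesis C_cdim : cdim_le S (range (base \o (val : C -> A))) N.

Lemma mdim_at_glue r m (kappa : nat -> nat) (J : nat -> Prop) :
  (forall h, (kappa h <= h)%N) -> {homo kappa : h k / (h <= k)%N} ->
  (forall h, kappa (kappa h) = kappa h) ->
  (forall h k, (0 < kappa h)%N -> (kappa h < kappa k)%N ->
    (kappa h + (collar_width r N + 4 * r).+1 <= kappa k)%N) ->
  (forall h k, (h <= k)%N -> J k -> J h) ->
  (forall h, J h -> (h <= kappa h + m)%N) ->
  mdim_le S [set x : G | (size (stk x) <= m)%N] N ->
  mdim_at S [set x : G | J (size (stk x))] r N.
Proof.
move=> k_le k_mono k_idem k_gap J_down J_k dm.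
have [DC [IC [colC [labC [col_lt bdC sepC]]]]] :=
  cdim_nbhd (collar_width r N).+1 C_cdim (r + r).
(* The collar cover comes first: the scale for the pieces must include the distance
   [DC + collar_width r N] by which anchoring moves points. *)
have [DL [IL [lam [bdL mlL]]]] := dm (r + (DC + collar_width r N))%N.
exists (DL + 2 * (DC + collar_width r N))%N, (@label A IC IL).
exists (glued_label (phi := phi) SA r N kappa J colC labC lam); split.
- by move=> x y; apply: (glued_label_bounded phi_inj k_le J_down J_k bdC bdL).
- exact: (glued_label_mult phi_inj k_le k_mono k_idem k_gap J_down J_k col_lt bdC sepC mlL).
Qed.

Hypothesis A_mdim : mdim_le S (range base) N.

Lemma mdim_le_ball m : mdim_le S [set x : G | (size (stk x) <= m)%N] N.
Proof.
elim: m => [|m IH] r.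
  have [D [I [lab [bd ml]]]] := A_mdim r; exists D, I, lab.
  have baseP x : (size (stk x) <= 0)%N -> range base x.
    rewrite leqn0 size_eq0 => /eqP x0; exists (nform x).2 => //.
    by rewrite [RHS](nform_stkE phi_inj) x0 /= mul1g.
  split=> [x y /baseP Ax /baseP Ay|z]; first exact: bd.
  by have [s [sN sP]] := ml z; exists s; split=> // y /baseP; apply: sP.
(* The only cuts are at height [m + 1], and the pieces below them have relative height 0. *)
apply: (mdim_at_glue (m := m) (kappa := fun h => if (h <= m)%N then 0%N else m.+1)
  (J := fun h => (h <= m.+1)%N)) => //=.
- by move=> h; case: (leqP h m).
- by move=> h k; case: (leqP h m); case: (leqP k m) => //; lia.
- by move=> h; case: (leqP h m) => //; rewrite ltnn.
- by move=> h k; case: (leqP h m); case: (leqP k m) => //; lia.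
- by move=> h k; lia.
- by move=> h; case: (leqP h m); lia.
Qed.

Lemma mdim_le_hnn : mdim_le S [set: G] N.
Proof.
move=> r; pose M := (collar_width r N + 4 * r).+1.
suff : mdim_at S [set x : G | (fun=> True) (size (stk x))] r N by [].
apply: (mdim_at_glue (m := M) (kappa := fun h => (h %/ M * M)%N) (J := fun=> True)) => //.
- by move=> h; exact: leq_trunc_div.
- by move=> h k hk; rewrite leq_mul2r leq_div2r ?orbT.
- by move=> h; rewrite mulnK.
- by move=> h k _; rewrite ltn_pmul2r // -/M addnC -mulSn leq_pmul2r.
- by move=> h _; rewrite {1}(divn_eq h M) leq_add2l ltnW // ltn_pmod.
- exact: mdim_le_ball.
Qed.

End HNNDimension.

Theorem theoremA1 (R : realType) (A : groupType) (P : pred A)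
    (C : subGroupType P) (phi : {multiplicative C -> A})
    (phi_inj : injective phi)
    (SA : genset A) (SC : genset C) (SG : genset (hnn phi)) :
  (asdim (word_space R SG) <=
     Order.max (asdim (word_space R SA)) (asdim (word_space R SC) + 1))%E.
Proof.
have [->|[a da le_a]] := asdim_fin_or_oo (word_space R SA).
  by rewrite maxye leey.
have [->|[c dc le_c]] := asdim_fin_or_oo (word_space R SC).
  by rewrite addye // maxey leey.
pose N := maxn a c.+1; pose S := hnn_genset phi SA.
have base_inj := hnn_base_inj phi_inj.
have dC : cdim_le S (range (hnn_base phi \o (val : C -> A))) N.
  apply: (@cdim_le_mono _ _ _ c.+1); first exact: leq_maxr.
  apply/mdim_cdim/(asdim_at_most_mdim (SH := SC)) => //; last exact: dc.
    by move=> x y /=; rewrite gmulfM hnn_baseM.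
  by apply: inj_comp; [exact: base_inj|exact: val_inj].
have dA : mdim_le S (range (hnn_base phi)) N.
  apply: (@mdim_le_mono _ _ _ a); first exact: leq_maxl.
  by apply: (asdim_at_most_mdim (SH := SA)) => //; [exact: hnn_baseM|exact: da].
(* The identity map passes from the generating set [S] to the given [SG]. *)
have dG : asdim_at_most (X := word_space R SG) N.
  exact: (mdim_asdim_at_most SG (f := id) _ _ (mdim_le_hnn phi_inj dC dA)).
apply: (@le_trans _ _ (N%:R%:E)%E); first by apply: ereal_inf_lbound; exists N.
rewrite /N; case: (leqP a c.+1) => _; rewrite le_max.
  by apply/orP; right; rewrite -natr1 EFinD leeD2r.
by rewrite le_a.
Qed.
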